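(* Let $\mathcal{C}$ be a triangulated category. The assignments $$\Psi:(\mathcal{X},\mathcal{Y})\mapsto \xi_{\mathcal{X}}=\xi^{\mathcal{Y}}\qquad\text{and}\qquad \Phi:\xi\mapsto(\mathcal{P}(\xi),\mathcal{I}(\xi))$$ give mutually inverse bijections between the following classes: (1) balanced pairs $(\mathcal{X},\mathcal{Y})$ in $\mathcal{C}$; (2) proper classes $\xi$ of triangles in $\mathcal{C}$ with enough $\xi$-projectives and enough $\xi$-injectives.
   Context: $\mathcal{C}=(\mathcal{C},\Sigma,\Delta)$ is a triangulated category with suspension functor $\Sigma$ and class of (distinguished) triangles $\Delta$; ''triangle'' means element of $\Delta$. A triangle $A\xrightarrow{f}B\xrightarrow{g}C\xrightarrow{h}\Sigma A$ is split if $h=0$; $\Delta_0\subseteq\Delta$ is the class of split triangles. **Proper classes.** Given a triangle $A\xrightarrow{f}B\xrightarrow{g}C\xrightarrow{h}\Sigma A$ and a morphism $\varepsilon:E\to C$, a base change diagram is a commutative diagram of triangles consisting of rows $A\xrightarrow{f'}G\xrightarrow{g'}E\xrightarrow{h'}\Sigma A$ and $A\xrightarrow{f}B\xrightarrow{g}C\xrightarrow{h}\Sigma A$ and columns $M\xrightarrow{\alpha}G\xrightarrow{\beta}B\xrightarrow{\gamma}\Sigma M$ and $M\xrightarrow{\delta}E\xrightarrow{\varepsilon}C\xrightarrow{\zeta}\Sigma M$, with $\beta f'=f$, $g\beta=\varepsilon g'$, $h'=h\varepsilon$, $g'\alpha=\delta$, $\gamma=\zeta g$. A class $\xi$ of triangles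 is closed under base change if in every such diagram $(f,g,h)\in\xi$ implies $(f',g',h')\in\xi$. Dually, $\xi$ is closed under cobase change if for $(f,g,h)\in\xi$ and any $\alpha:A\to D$, the triangle $D\to F\to C\xrightarrow{(\Sigma\alpha) h}\Sigma D$ obtained by cobase change lies in $\xi$. $\xi$ is closed under suspensions if $(f,g,h)\in\xi$ implies that the triangle $\Sigma^iA\to\Sigma^iB\to\Sigma^iC\to\Sigma^{i+1}A$ with morphisms $(-1)^i\Sigma^if,(-1)^i\Sigma^ig,(-1)^i\Sigma^ih$ is in $\xi$ for all $i\in\mathbb{Z}$. $\xi$ is saturated if in every base change diagram, $(\delta,\varepsilon,\zeta)\in\xi$ and $(f',g',h')\in\xi$ imply $(f,g,h)\in\xi$. A proper class of triangles is a full subcategory $\xi\subseteq\Delta$ that is closed under isomorphisms and finite coproducts, satisfies $\Delta_0\subseteq\xi\subseteq\Delta$, is closed under suspensions, is saturated, and is closed under base change and cobase change. **Projectives and injectives.** For a proper class $\xi$, an object $P$ is $\xi$-projective if for every triangle $A\to B\to C\to\Sigma A$ in $\xi$ the sequence $0\to\mathcal{C}(P,A)\to\mathcal{C}(P,B)\to\mathcal{C}(P,C)\to0$ is exact; $I$ is $\xi$-injective if for every such triangle $0\to\mathcal{C}(C,I)\to\mathcal{C}(B,I)\to\mathcal{C}(A,I)\to0$ is exact. $\mathcal{P}(\xi)$ and $\mathcal{I}(\xi)$ are the full subcategories of $\xi$-projective and $\xi$-injective objects. $\mathcal{C}$ has enough $\xi$-projectives if for each object $A$ there is a triangle $K\to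 P\to A\to\Sigma K$ in $\xi$ with $P\in\mathcal{P}(\xi)$, and enough $\xi$-injectives if for each $A$ there is a triangle $A\to I\to K\to\Sigma A$ in $\xi$ with $I\in\mathcal{I}(\xi)$. **The classes $\xi_{\mathcal{X}}$ and $\xi^{\mathcal{Y}}$.** A subcategory $\mathcal{X}$ is $\Sigma$-stable if $\Sigma(\mathcal{X})=\mathcal{X}$. For a $\Sigma$-stable full additive subcategory $\mathcal{X}$, $\xi_{\mathcal{X}}$ is the class of triangles $A\xrightarrow{f}B\xrightarrow{g}C\xrightarrow{h}\Sigma A$ that are $\mathcal{C}(\mathcal{X},-)$-exact, i.e. for every $X\in\mathcal{X}$, $\mathcal{C}(X,f)$ is a monomorphism and $\mathcal{C}(X,g)$ is an epimorphism (by $\Sigma$-stability, either condition for all $X\in\mathcal{X}$ implies the other). For a $\Sigma$-stable full additive subcategory $\mathcal{Y}$, $\xi^{\mathcal{Y}}$ is the class of triangles that are $\mathcal{C}(-,\mathcal{Y})$-exact, i.e. for every $Y\in\mathcal{Y}$, $\mathcal{C}(g,Y)$ is a monomorphism and $\mathcal{C}(f,Y)$ is an epimorphism (again either implies the other). **Resolutions.** For a proper class $\xi$, a $\xi$-exact complex is a diagram $\cdots\to X_1\xrightarrow{d_1}X_0\xrightarrow{d_0}X_{-1}\to\cdots$ for which there are triangles $K_{n+1}\xrightarrow{g_n}X_n\xrightarrow{f_n}K_n\xrightarrow{h_n}\Sigma K_{n+1}$ in $\xi$ with $d_n=g_{n-1}f_n$. It is called $\mathcal{C}(-,\mathcal{Y})$-exact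 (resp. $\mathcal{C}(\mathcal{X},-)$-exact) if these triangles can be chosen to be moreover $\mathcal{C}(-,\mathcal{Y})$-exact (resp. $\mathcal{C}(\mathcal{X},-)$-exact). An $\mathcal{X}$-resolution of $M$ is a $\xi_{\mathcal{X}}$-exact complex $\cdots\to X_1\to X_0\to M$ with all $X_i\in\mathcal{X}$ (so the triangles are indexed by $n\ge0$ with $K_0=M$). A $\mathcal{Y}$-coresolution of $M$ is a $\xi^{\mathcal{Y}}$-exact complex $M\to Y_0\to Y_{-1}\to\cdots$ with all $Y_i\in\mathcal{Y}$ (the dual notion). $\mathcal{X}$ is contravariantly finite if every $C\in\mathcal{C}$ admits a morphism $X\to C$ with $X\in\mathcal{X}$ such that $\mathcal{C}(X',X)\to\mathcal{C}(X',C)$ is surjective for all $X'\in\mathcal{X}$; $\mathcal{Y}$ is covariantly finite if every $C$ admits $C\to Y$ with $Y\in\mathcal{Y}$ such that $\mathcal{C}(Y,Y')\to\mathcal{C}(C,Y')$ is surjective for all $Y'\in\mathcal{Y}$. **Balanced pairs.** A pair $(\mathcal{X},\mathcal{Y})$ of $\Sigma$-stable full additive subcategories of $\mathcal{C}$, both closed under direct summands, is a balanced pair if it satisfies the following equivalent conditions: (i) $\xi_{\mathcal{X}}=\xi^{\mathcal{Y}}$, $\mathcal{X}=\mathcal{P}(\xi_{\mathcal{X}})$, $\mathcal{Y}=\mathcal{I}(\xi^{\mathcal{Y}})$, and $\mathcal{C}$ has enough $\xi_{\mathcal{X}}$-projectives and enough $\xi^{\mathcal{Y}}$-injectives; (ii)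 $\mathcal{X}$ is contravariantly finite and $\mathcal{Y}$ is covariantly finite in $\mathcal{C}$, every object $M$ has an $\mathcal{X}$-resolution that is $\mathcal{C}(-,\mathcal{Y})$-exact, and every object $N$ has a $\mathcal{Y}$-coresolution that is $\mathcal{C}(\mathcal{X},-)$-exact. *)

(* Defs.v *)
From mathcomp Require Import all_boot all_algebra.
From mathcomp Require Import boolp classical_sets functions.

Set Implicit Arguments.
Unset Strict Implicit.
Unset Printing Implicit Defensive.

Import GRing.Theory.
Local Open Scope ring_scope.
Local Open Scope classical_set_scope.

Declare Scope cat_scope.
Delimit Scope cat_scope with cat.
Local Open Scope cat_scope.

(** * Additive categories *)

Record preadditive := Preadditive {
  obj :> Type;
  hom : obj -> obj -> zmodType;
  idm : forall A, hom A A;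
  comp : forall A B D, hom B D -> hom A B -> hom A D;
  comp1m : forall A B (f : hom A B), comp (idm B) f = f;
  compm1 : forall A B (f : hom A B), comp f (idm A) = f;
  compA : forall A B D E (h : hom D E) (g : hom B D) (f : hom A B),
    comp h (comp g f) = comp (comp h g) f;
  compDl : forall A B D (g g' : hom B D) (f : hom A B),
    comp (g + g') f = comp g f + comp g' f;
  compDr : forall A B D (g : hom B D) (f f' : hom A B),
    comp g (f + f') = comp g f + comp g f' }.

Arguments hom {p} A B.
Arguments idm {p} A.
Arguments comp {p A B D} g f.

Notation "g ∘ f" := (comp g f) (at level 40, left associativity) : cat_scope.

Section Preadditive.
Variable C : preadditive.

Definition is_iso (A B : C) (f : hom A B) : Prop :=
  exists g : hom B A, g ∘ f = idm A /\ f ∘ g = idm B.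

Definition isomorphic (A B : C) : Prop := exists f : hom A B, is_iso f.

Definition is_zero (Z : C) : Prop := idm Z = 0.

(* [S] is the biproduct of [A] and [B], with injections [i], [j] and
   projections [p], [q]. *)
Definition is_biproduct (A B S : C) (i : hom A S) (j : hom B S)
    (p : hom S A) (q : hom S B) : Prop :=
  [/\ p ∘ i = idm A, q ∘ j = idm B, p ∘ j = 0, q ∘ i = 0
    & i ∘ p + j ∘ q = idm S].

Definition is_coprod (A B S : C) (i : hom A S) (j : hom B S) : Prop :=
  forall (T : C) (u : hom A T) (v : hom B T),
    exists! w : hom S T, w ∘ i = u /\ w ∘ j = v.

Definition is_additive : Prop :=
  (exists Z : C, is_zero Z) /\
  (forall A B : C, exists (S : C) (i : hom A S) (j : hom B S)
     (p : hom S A) (q : hom S B), is_biproduct i j p q).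

Record additive_functor := AdditiveFunctor {
  fobj :> C -> C;
  fmor : forall A B : C, hom A B -> hom (fobj A) (fobj B);
  fmor1 : forall A, fmor (idm A) = idm (fobj A);
  fmorM : forall (A B D : C) (g : hom B D) (f : hom A B),
    fmor (g ∘ f) = fmor g ∘ fmor f;
  fmorD : forall (A B : C) (f g : hom A B), fmor (f + g) = fmor f + fmor g }.

End Preadditive.

Arguments fmor {C} a {A B} f.

(** * Triangulated categories *)

(* The suspension [Sg] is an auto-equivalence, given as an adjoint equivalence
   with quasi-inverse [Sg'].  When it is an automorphism, [sgV_sg] and
   [sg_sgV] are identities. *)
Record suspended := Suspended {
  scat :> preadditive;
  scat_additive : is_additive scat;
  Sg : additive_functor scat;
  Sg' : additive_functor scat;
  sgV_sg : forall A : scat, hom (Sg' (Sg A)) A;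
  sg_sgV : forall A : scat, hom A (Sg (Sg' A));
  sgV_sg_iso : forall A, is_iso (sgV_sg A);
  sg_sgV_iso : forall A, is_iso (sg_sgV A);
  sgV_sg_nat : forall (A B : scat) (f : hom A B),
    f ∘ sgV_sg A = sgV_sg B ∘ fmor Sg' (fmor Sg f);
  sg_sgV_nat : forall (A B : scat) (f : hom A B),
    sg_sgV B ∘ f = fmor Sg (fmor Sg' f) ∘ sg_sgV A;
  sg_triangle : forall A : scat,
    fmor Sg (sgV_sg A) ∘ sg_sgV (Sg A) = idm (Sg A) }.

Arguments Sg {s}.
Arguments Sg' {s}.
Arguments sgV_sg {s} A.
Arguments sg_sgV {s} A.

(* Candidate triangles; the distinguished ones are singled out below. *)
Record tri (C : suspended) := Tri {
  tA : C; tB : C; tC : C;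
  tf : hom tA tB; tg : hom tB tC; th : hom tC (Sg tA) }.

Arguments Tri {C tA tB tC} tf tg th.

Section Suspended.
Variable C : suspended.

Record tri_mor (s t : tri C) := TriMor {
  mA : hom (tA s) (tA t);
  mB : hom (tB s) (tB t);
  mC : hom (tC s) (tC t);
  mAB : mB ∘ tf s = tf t ∘ mA;
  mBC : mC ∘ tg s = tg t ∘ mB;
  mCA : fmor Sg mA ∘ th s = th t ∘ mC }.

Definition tri_iso (s t : tri C) : Prop :=
  exists m : tri_mor s t, [/\ is_iso (mA m), is_iso (mB m) & is_iso (mC m)].

Definition iso_closed (xi : set (tri C)) : Prop :=
  forall s t, tri_iso s t -> xi s -> xi t.

Definition TR1 (Delta : set (tri C)) : Prop :=
  (forall (A Z : C), is_zero Z ->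
     Delta (Tri (idm A) (0 : hom A Z) (0 : hom Z (Sg A)))) /\
  (forall (A B : C) (f : hom A B),
     exists (D : C) (g : hom B D) (h : hom D (Sg A)), Delta (Tri f g h)).

Definition TR2 (Delta : set (tri C)) : Prop :=
  forall (A B D : C) (f : hom A B) (g : hom B D) (h : hom D (Sg A)),
    Delta (Tri f g h) <-> Delta (Tri g h (- fmor Sg f)).

Definition TR3 (Delta : set (tri C)) : Prop :=
  forall (s t : tri C) (a : hom (tA s) (tA t)) (b : hom (tB s) (tB t)),
    Delta s -> Delta t -> b ∘ tf s = tf t ∘ a ->
    exists c : hom (tC s) (tC t),
      c ∘ tg s = tg t ∘ b /\ fmor Sg a ∘ th s = th t ∘ c.

Definition TR4 (Delta : set (tri C)) : Prop :=
  forall (X Y Z U V W : C) (f : hom X Y) (g : hom Y Z)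
    (f1 : hom Y U) (f2 : hom U (Sg X))
    (g1 : hom Z V) (g2 : hom V (Sg Y))
    (k1 : hom Z W) (k2 : hom W (Sg X)),
    Delta (Tri f f1 f2) -> Delta (Tri g g1 g2) -> Delta (Tri (g ∘ f) k1 k2) ->
    exists (u : hom U W) (v : hom W V),
      [/\ Delta (Tri u v (fmor Sg f1 ∘ g2)),
          u ∘ f1 = k1 ∘ g, k2 ∘ u = f2, v ∘ k1 = g1
        & fmor Sg f ∘ k2 = g2 ∘ v].

End Suspended.

Record triangulated := Triangulated {
  tcat :> suspended;
  Delta : set (tri tcat);
  Delta_iso : iso_closed Delta;
  Delta_TR1 : TR1 Delta;
  Delta_TR2 : TR2 Delta;
  Delta_TR3 : TR3 Delta;
  Delta_TR4 : TR4 Delta }.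

Arguments Delta {t}.

(** * Proper classes of triangles *)

Section ProperClasses.
Variable C : triangulated.
Implicit Types (xi : set (tri C)) (t : tri C).

Definition split_triangles : set (tri C) := [set t | Delta t /\ th t = 0].

(* [Sg^n] and [Sg^-n] on triangles are obtained by iterating these; the sign
   of each step produces the factor [(-1)^n].  In [tri_desusp] the last
   morphism is [Sg' h] followed by [Sg' (Sg A) ~ A ~ Sg (Sg' A)]. *)
Definition tri_susp t : tri C :=
  Tri (- fmor Sg (tf t)) (- fmor Sg (tg t)) (- fmor Sg (th t)).

Definition tri_desusp t : tri C :=
  Tri (- fmor Sg' (tf t)) (- fmor Sg' (tg t))
      (- (sg_sgV (tA t) ∘ sgV_sg (tA t) ∘ fmor Sg' (th t))).

Definition tri_shift (i : int) t : tri C :=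
  match i with
  | Posz n => iter n tri_susp t
  | Negz n => iter n.+1 tri_desusp t
  end.

Definition susp_closed xi : Prop :=
  forall (i : int) t, xi t -> xi (tri_shift i t).

(* Coproducts in the category of triangles are formed termwise; the empty one
   is the zero triangle. *)
Definition tri_coprod (s s' t : tri C) : Prop :=
  exists (i : tri_mor s t) (j : tri_mor s' t),
    [/\ is_coprod (mA i) (mA j), is_coprod (mB i) (mB j)
      & is_coprod (mC i) (mC j)].

Definition coprod_closed xi : Prop :=
  (forall t, Delta t ->
     is_zero (tA t) -> is_zero (tB t) -> is_zero (tC t) -> xi t) /\
  (forall s s' t, Delta t -> xi s -> xi s' -> tri_coprod s s' t -> xi t).

(*   M ==== M
     |a     |d
  A -f'> G -g'> E -h'> Sg A
  ||     |b     |e      ||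
  A -f-> B -g-> D -h-> Sg A
         |c     |z
        Sg M == Sg M              *)
Record base_change (A B D E G M : C)
    (f : hom A B) (g : hom B D) (h : hom D (Sg A))
    (f' : hom A G) (g' : hom G E) (h' : hom E (Sg A))
    (a : hom M G) (b : hom G B) (c : hom B (Sg M))
    (d : hom M E) (e : hom E D) (z : hom D (Sg M)) : Prop := BaseChange {
  bc_row : Delta (Tri f g h);
  bc_row' : Delta (Tri f' g' h');
  bc_colB : Delta (Tri a b c);
  bc_colD : Delta (Tri d e z);
  bc_f : b ∘ f' = f;
  bc_g : g ∘ b = e ∘ g';
  bc_h : h' = h ∘ e;
  bc_d : g' ∘ a = d;
  bc_c : c = z ∘ g }.

(*   N ==== N
     |z     |d
     A -f-> B -g-> D -h-> Sg A
     |a     |b     ||      |Sg a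
     E -f'> F -g'> D -h'> Sg E
     |e     |c
   Sg N == Sg N                   *)
Record cobase_change (A B D E F N : C)
    (f : hom A B) (g : hom B D) (h : hom D (Sg A))
    (f' : hom E F) (g' : hom F D) (h' : hom D (Sg E))
    (z : hom N A) (a : hom A E) (e : hom E (Sg N))
    (d : hom N B) (b : hom B F) (c : hom F (Sg N)) : Prop := CobaseChange {
  cbc_row : Delta (Tri f g h);
  cbc_row' : Delta (Tri f' g' h');
  cbc_colA : Delta (Tri z a e);
  cbc_colB : Delta (Tri d b c);
  cbc_f : b ∘ f = f' ∘ a;
  cbc_g : g' ∘ b = g;
  cbc_h : h' = fmor Sg a ∘ h;
  cbc_d : f ∘ z = d;
  cbc_e : e = c ∘ f' }.

Definition base_change_closed xi : Prop :=
  forall (A B D E G M : C) (f : hom A B) (g : hom B D) (h : hom D (Sg A))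
    (f' : hom A G) (g' : hom G E) (h' : hom E (Sg A))
    (a : hom M G) (b : hom G B) (c : hom B (Sg M))
    (d : hom M E) (e : hom E D) (z : hom D (Sg M)),
    base_change f g h f' g' h' a b c d e z ->
    xi (Tri f g h) -> xi (Tri f' g' h').

Definition cobase_change_closed xi : Prop :=
  forall (A B D E F N : C) (f : hom A B) (g : hom B D) (h : hom D (Sg A))
    (f' : hom E F) (g' : hom F D) (h' : hom D (Sg E))
    (z : hom N A) (a : hom A E) (e : hom E (Sg N))
    (d : hom N B) (b : hom B F) (c : hom F (Sg N)),
    cobase_change f g h f' g' h' z a e d b c ->
    xi (Tri f g h) -> xi (Tri f' g' h').

Definition saturated xi : Prop :=
  forall (A B D E G M : C) (f : hom A B) (g : hom B D) (h : hom D (Sg A))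
    (f' : hom A G) (g' : hom G E) (h' : hom E (Sg A))
    (a : hom M G) (b : hom G B) (c : hom B (Sg M))
    (d : hom M E) (e : hom E D) (z : hom D (Sg M)),
    base_change f g h f' g' h' a b c d e z ->
    xi (Tri d e z) -> xi (Tri f' g' h') -> xi (Tri f g h).

Record proper_class xi : Prop := ProperClass {
  proper_sub : xi `<=` Delta;
  proper_split : split_triangles `<=` xi;
  proper_iso : iso_closed xi;
  proper_coprod : coprod_closed xi;
  proper_susp : susp_closed xi;
  proper_saturated : saturated xi;
  proper_base_change : base_change_closed xi;
  proper_cobase_change : cobase_change_closed xi }.

(** * Projectives, injectives and balanced pairs *)

(* Exactness of [0 -> U -> V -> W -> 0]. *)
Definition short_exact (U V W : zmodType) (u : U -> V) (v : V -> W) : Prop :=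
  [/\ injective u, (forall y, v y = 0 <-> exists x, u x = y)
    & forall w, exists y, v y = w].

Definition is_projective xi (P : C) : Prop :=
  forall t, xi t ->
    short_exact (fun u : hom P (tA t) => tf t ∘ u)
                (fun u : hom P (tB t) => tg t ∘ u).

Definition is_injective xi (I : C) : Prop :=
  forall t, xi t ->
    short_exact (fun u : hom (tC t) I => u ∘ tg t)
                (fun u : hom (tB t) I => u ∘ tf t).

Definition Proj xi : set C := [set P | is_projective xi P].
Definition Inj xi : set C := [set I | is_injective xi I].

Definition enough_projectives xi : Prop :=
  forall A : C, exists (K P : C) (f : hom K P) (g : hom P A) (h : hom A (Sg K)),
    Proj xi P /\ xi (Tri f g h).

Definition enough_injectives xi : Prop :=
  forall A : C, exists (I K : C) (f : hom A I) (g : hom I K) (h : hom K (Sg A)),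
    Inj xi I /\ xi (Tri f g h).

(* Full subcategories are represented by their classes of objects. *)
Implicit Types X Y : set C.

(* [Sg(X) = X], the image under the equivalence [Sg] being taken up to
   isomorphism. *)
Definition sg_stable X : Prop :=
  (forall A, X A -> X (Sg A)) /\
  (forall B, X B -> exists A : C, X A /\ isomorphic B (Sg A)).

Definition additive_subcat X : Prop :=
  (exists Z : C, X Z /\ is_zero Z) /\
  (forall A B, X A -> X B -> exists (S : C) (i : hom A S) (j : hom B S)
     (p : hom S A) (q : hom S B), X S /\ is_biproduct i j p q).

(* This includes closure under isomorphism (take [A'] to be zero). *)
Definition summand_closed X : Prop :=
  forall (A A' S : C) (i : hom A S) (j : hom A' S) (p : hom S A) (q : hom S A'),
    is_biproduct i j p q -> X S -> X A.

Definition xi_contra X : set (tri C) :=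
  [set t | Delta t /\ forall P, X P ->
    injective (fun u : hom P (tA t) => tf t ∘ u) /\
    forall w : hom P (tC t), exists u : hom P (tB t), tg t ∘ u = w].

Definition xi_co Y : set (tri C) :=
  [set t | Delta t /\ forall I, Y I ->
    injective (fun u : hom (tC t) I => u ∘ tg t) /\
    forall w : hom (tA t) I, exists u : hom (tB t) I, u ∘ tf t = w].

Definition contravariantly_finite X : Prop :=
  forall D : C, exists (P : C) (p : hom P D), X P /\
    forall (P' : C), X P' -> forall w : hom P' D, exists u : hom P' P, p ∘ u = w.

Definition covariantly_finite Y : Prop :=
  forall D : C, exists (I : C) (j : hom D I), Y I /\
    forall (I' : C), Y I' -> forall w : hom D I', exists u : hom I I', u ∘ j = w.

(* The objects [K_0 = M, K_1, K_2, ...]. *)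
Definition syzygy (M : C) (K : nat -> C) (n : nat) : C :=
  if n is m.+1 then K m else M.

(* The complex [... -> X_1 -> X_0 -> M] with differentials [d n] and
   augmentation [aug] decomposes into triangles
   [K_(n+1) -g n-> X_n -f n-> K_n -h n-> Sg K_(n+1)] of [xi], where [K_0 = M]. *)
Definition exact_left xi (M : C) (Xs : nat -> C)
    (d : forall n, hom (Xs n.+1) (Xs n)) (aug : hom (Xs 0%N) M) : Prop :=
  exists (K : nat -> C)
    (g : forall n, hom (syzygy M K n.+1) (Xs n))
    (f : forall n, hom (Xs n) (syzygy M K n))
    (h : forall n, hom (syzygy M K n) (Sg (syzygy M K n.+1))),
    [/\ aug = f 0%N, forall n, d n = g n ∘ f n.+1
      & forall n, xi (Tri (g n) (f n) (h n))].

(* Dually for [M -> Y_0 -> Y_(-1) -> ...], with [Ys n] for [Y_(-n)], and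
   triangles [K_n -g n-> Y_(-n) -f n-> K_(n+1) -h n-> Sg K_n], [K_0 = M]. *)
Definition exact_right xi (M : C) (Ys : nat -> C)
    (d : forall n, hom (Ys n) (Ys n.+1)) (coaug : hom M (Ys 0%N)) : Prop :=
  exists (K : nat -> C)
    (g : forall n, hom (syzygy M K n) (Ys n))
    (f : forall n, hom (Ys n) (syzygy M K n.+1))
    (h : forall n, hom (syzygy M K n.+1) (Sg (syzygy M K n))),
    [/\ coaug = g 0%N, forall n, d n = g n.+1 ∘ f n
      & forall n, xi (Tri (g n) (f n) (h n))].

Definition has_resolution X Y (M : C) : Prop :=
  exists (Xs : nat -> C) (d : forall n, hom (Xs n.+1) (Xs n))
    (aug : hom (Xs 0%N) M),
    (forall n, X (Xs n)) /\ exact_left (xi_contra X `&` xi_co Y) d aug.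

Definition has_coresolution X Y (N : C) : Prop :=
  exists (Ys : nat -> C) (d : forall n, hom (Ys n) (Ys n.+1))
    (coaug : hom N (Ys 0%N)),
    (forall n, Y (Ys n)) /\ exact_right (xi_co Y `&` xi_contra X) d coaug.

Definition admissible_subcat X : Prop :=
  [/\ sg_stable X, additive_subcat X & summand_closed X].

(* Balanced pairs, defined through projectives and injectives
   ([balanced_proj_inj]) or through resolutions ([balanced_resolution]). *)
Definition balanced_proj_inj : set (set C * set C) :=
  [set p | let: (X, Y) := p in
    [/\ admissible_subcat X, admissible_subcat Y, xi_contra X = xi_co Y
      & [/\ X = Proj (xi_contra X), Y = Inj (xi_co Y),
            enough_projectives (xi_contra X) & enough_injectives (xi_co Y)]]].

Definition balanced_resolution : set (set C * set C) :=
  [set p | let: (X, Y) := p in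
    [/\ admissible_subcat X, admissible_subcat Y,
        contravariantly_finite X /\ covariantly_finite Y,
        forall M, has_resolution X Y M & forall N, has_coresolution X Y N]].

Definition proper_enough : set (set (tri C)) :=
  [set xi | [/\ proper_class xi, enough_projectives xi & enough_injectives xi]].

Definition Psi (p : set C * set C) : set (tri C) := xi_contra p.1.
Definition Phi xi : set C * set C := (Proj xi, Inj xi).

End ProperClasses.

Arguments split_triangles C _ : clear implicits.
Arguments balanced_proj_inj C _ : clear implicits.
Arguments balanced_resolution C _ : clear implicits.
Arguments proper_enough C _ : clear implicits.
Arguments xi_contra {C} X.
Arguments xi_co {C} Y.
Arguments Psi {C} p.
Arguments Phi {C} xi.

(* Main.v *)
From mathcomp Require Import all_boot all_algebra.
From mathcomp Require Import boolp classical_sets functions.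
Require Import Defs.

Set Implicit Arguments.
Unset Strict Implicit.
Unset Printing Implicit Defensive.

Import GRing.Theory.
Local Open Scope classical_set_scope.

(** A triangle [A -f-> B -g-> D -h-> Sg A] is read off its connecting morphism
    [h]. Exactness of [Hom (P, -)] on it, for all [P] in a suspension-stable
    class [X], says that [h] kills every morphism from [X] to [D]
    ([xi_contraP]); dually, exactness of [Hom (-, I)] for all [I] in [Y] says
    that [Sg w ∘ h = 0] for every [w] from [A] to [Y] ([xi_coP]). In these
    terms a proper class is closed under precomposing [h] with morphisms of the
    category and postcomposing it with suspended ones: the diagrams of base and
    cobase change that witness this always exist, by the octahedral axiom
    ([base_change_exists], [cobase_change_exists]). Conversely [xi_contra X]
    is a proper class because the morphisms that kill everything coming from a
    stable class form a suspension-stable ideal ([xi_contra_proper]).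

    Let [xi] be proper with enough projectives and injectives. If [h] kills all
    morphisms from projectives, take a triangle [K -> P -p-> D -z-> Sg K] of
    [xi] with [P] projective. Then [h ∘ p = 0], so [h] factors as [Sg w ∘ z],
    and the triangle on [h] lies in [xi] because the one on [z] does; hence
    [xi_contra (Proj xi) = xi] ([xi_contra_Proj]). Using a triangle
    [A -> I -> K -k-> Sg A] with [I] injective, [h] factors as [k ∘ w], and
    [xi_co (Inj xi) = xi] ([xi_co_Inj]). So [Phi] lands in balanced pairs and
    [Psi] undoes it; that [Phi] undoes [Psi] is part of the definition of a
    balanced pair through projectives and injectives.

    The same two factorizations, applied to the first triangle of a resolution
    of [D] or of a coresolution of [A], show that the conditions on resolutions
    force [xi_contra X = xi_co Y]. A projective object splits off the first term
    of its resolution, so that [Proj (xi_contra X)] is [X]; dually for [Y].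
    Conversely, resolutions are spliced from the triangles provided by enough
    projectives. Therefore the two definitions of a balanced pair agree
    ([balanced_resolutionE]). *)

(** * Preadditive categories *)

Section Preadditive.
Local Open Scope ring_scope.
Local Open Scope cat_scope.
Variable C : preadditive.

Lemma comp0m (A B D : C) (f : hom A B) : (0 : hom B D) ∘ f = 0.
Proof. by apply: (addrI ((0 : hom B D) ∘ f)); rewrite -compDl !addr0. Qed.

Lemma compm0 (A B D : C) (g : hom B D) : g ∘ (0 : hom A B) = 0.
Proof. by apply: (addrI (g ∘ (0 : hom A B))); rewrite -compDr !addr0. Qed.

Lemma compNm (A B D : C) (g : hom B D) (f : hom A B) : (- g) ∘ f = - (g ∘ f).
Proof. by apply: (addrI (g ∘ f)); rewrite -compDl !subrr comp0m. Qed.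

Lemma compmN (A B D : C) (g : hom B D) (f : hom A B) : g ∘ (- f) = - (g ∘ f).
Proof. by apply: (addrI (g ∘ f)); rewrite -compDr !subrr compm0. Qed.

Lemma compBl (A B D : C) (g g' : hom B D) (f : hom A B) :
  (g - g') ∘ f = g ∘ f - g' ∘ f.
Proof. by rewrite compDl compNm. Qed.

Lemma compBr (A B D : C) (g : hom B D) (f f' : hom A B) :
  g ∘ (f - f') = g ∘ f - g ∘ f'.
Proof. by rewrite compDr compmN. Qed.

Lemma fmor0 (F : additive_functor C) (A B : C) : fmor F (0 : hom A B) = 0.
Proof. by apply: (addrI (fmor F (0 : hom A B))); rewrite -fmorD !addr0. Qed.

Lemma fmorN (F : additive_functor C) (A B : C) (f : hom A B) :
  fmor F (- f) = - fmor F f.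
Proof. by apply: (addrI (fmor F f)); rewrite -fmorD !subrr fmor0. Qed.

Lemma is_iso_idm (A : C) : is_iso (idm A).
Proof. by exists (idm A); rewrite !comp1m. Qed.

Lemma is_isoN (A B : C) (f : hom A B) : is_iso f -> is_iso (- f).
Proof. by case=> g [gf fg]; exists (- g); rewrite !compNm !compmN !opprK. Qed.

Lemma iso_epi (A B D : C) (f : hom A B) (u v : hom B D) :
  is_iso f -> u ∘ f = v ∘ f -> u = v.
Proof.
by case=> g [_ fg] /(congr1 (fun x => x ∘ g)); rewrite -!compA fg !compm1.
Qed.

Lemma iso_mono (A B D : C) (f : hom A B) (u v : hom D A) :
  is_iso f -> f ∘ u = f ∘ v -> u = v.
Proof.
by case=> g [gf _] /(congr1 (fun x => g ∘ x)); rewrite !compA gf !comp1m.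
Qed.

Lemma hom_from0 (Z A : C) (u : hom Z A) : is_zero Z -> u = 0.
Proof. by move=> Z0; rewrite -[u]compm1 Z0 compm0. Qed.

Lemma hom_to0 (Z A : C) (u : hom A Z) : is_zero Z -> u = 0.
Proof. by move=> Z0; rewrite -[u]comp1m Z0 comp0m. Qed.

Lemma is_zero_fobj (F : additive_functor C) (Z : C) :
  is_zero Z -> is_zero (F Z).
Proof. by rewrite /is_zero => Z0; rewrite -fmor1 Z0 fmor0. Qed.

(** In an additive setting a coproduct carries projections, whose existence
    and compatibility both come from the universal property. *)
Lemma coprod_proj (A B S : C) (i : hom A S) (j : hom B S) :
  is_coprod i j ->
  exists (p : hom S A) (q : hom S B), i ∘ p + j ∘ q = idm S.
Proof.
move=> Sij; have [p [[pi pj] _]] := Sij A (idm A) 0.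
have [q [[qi qj] _]] := Sij B 0 (idm B).
exists p, q; have [w [_ wU]] := Sij S i j.
rewrite -(wU (idm S)); last by rewrite !comp1m.
apply/esym/wU; rewrite !compDl -!compA pi pj qi qj.
by rewrite !compm0 !compm1 addr0 add0r.
Qed.

End Preadditive.

(** * The suspension *)

Section Suspension.
Local Open Scope ring_scope.
Local Open Scope cat_scope.
Variable C : suspended.

Lemma Sg_inj (A B : C) (f g : hom A B) : fmor Sg f = fmor Sg g -> f = g.
Proof.
by move=> fg; apply: (iso_epi (sgV_sg_iso A)); rewrite !sgV_sg_nat fg.
Qed.

Lemma Sg'_inj (A B : C) (f g : hom A B) : fmor Sg' f = fmor Sg' g -> f = g.
Proof.
by move=> fg; apply: (iso_mono (sg_sgV_iso B)); rewrite !sg_sgV_nat fg.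
Qed.

Lemma Sg_eq0 (A B : C) (f : hom A B) : fmor Sg f = 0 -> f = 0.
Proof. by move=> f0; apply: Sg_inj; rewrite f0 fmor0. Qed.

Lemma Sg'_eq0 (A B : C) (f : hom A B) : fmor Sg' f = 0 -> f = 0.
Proof. by move=> f0; apply: Sg'_inj; rewrite f0 fmor0. Qed.

(** Transport along the counit [Sg' (Sg A) ~ A]; that the preimage works can be
    checked after applying [Sg'], which is faithful. *)
Lemma Sg_full (A B : C) (v : hom (Sg A) (Sg B)) : exists u, v = fmor Sg u.
Proof.
have [e [eV Ve]] := sgV_sg_iso A.
exists (sgV_sg B ∘ fmor Sg' v ∘ e); apply: Sg'_inj.
apply: (iso_mono (sgV_sg_iso B)).
by rewrite -sgV_sg_nat -!compA eV compm1.
Qed.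

End Suspension.

(** * Triangles *)

Section Triangles.
Local Open Scope ring_scope.
Local Open Scope cat_scope.
Variable C : triangulated.

Lemma Delta_isoP (A B D A' B' D' : C)
    (f : hom A B) (g : hom B D) (h : hom D (Sg A))
    (f' : hom A' B') (g' : hom B' D') (h' : hom D' (Sg A'))
    (a : hom A A') (b : hom B B') (c : hom D D') :
  is_iso a -> is_iso b -> is_iso c ->
  b ∘ f = f' ∘ a -> c ∘ g = g' ∘ b -> fmor Sg a ∘ h = h' ∘ c ->
  Delta (Tri f g h) -> Delta (Tri f' g' h').
Proof.
move=> ia ib ic e1 e2 e3; apply: Delta_iso.
by exists (@TriMor C (Tri f g h) (Tri f' g' h') a b c e1 e2 e3).
Qed.

(** The isomorphism is [-1] on the object common to the two negated morphisms
    and the identity on the other two. *)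
Lemma Delta_signs (A B D : C) (f : hom A B) (g : hom B D) (h : hom D (Sg A)) :
  (Delta (Tri (- f) (- g) h) -> Delta (Tri f g h)) *
  (Delta (Tri (- f) g (- h)) -> Delta (Tri f g h)) *
  (Delta (Tri f (- g) (- h)) -> Delta (Tri f g h)).
Proof.
have i1 := @is_iso_idm C; have iN X := is_isoN (i1 X).
do ![split].
- apply: (Delta_isoP (i1 _) (iN _) (i1 _));
  by rewrite ?fmor1 ?compNm ?compmN ?opprK ?comp1m ?compm1.
- apply: (Delta_isoP (iN _) (i1 _) (i1 _));
  by rewrite ?fmorN ?fmor1 ?compNm ?compmN ?opprK ?comp1m ?compm1.
- apply: (Delta_isoP (i1 _) (i1 _) (iN _));
  by rewrite ?fmorN ?fmor1 ?compNm ?compmN ?opprK ?comp1m ?compm1.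
Qed.

Lemma Delta_rot (A B D : C) (f : hom A B) (g : hom B D) (h : hom D (Sg A)) :
  Delta (Tri f g h) -> Delta (Tri g h (- fmor Sg f)).
Proof. by move/Delta_TR2. Qed.

Lemma Delta_rot3 (A B D : C) (f : hom A B) (g : hom B D) (h : hom D (Sg A)) :
  Delta (Tri f g h) <->
  Delta (Tri (- fmor Sg f) (- fmor Sg g) (- fmor Sg h)).
Proof. by rewrite (Delta_TR2 f) (Delta_TR2 g) (Delta_TR2 h). Qed.

Lemma tri_fill_mor (A B D A' B' D' : C)
    (f : hom A B) (g : hom B D) (h : hom D (Sg A))
    (f' : hom A' B') (g' : hom B' D') (h' : hom D' (Sg A'))
    (a : hom A A') (b : hom B B') :
  Delta (Tri f g h) -> Delta (Tri f' g' h') -> b ∘ f = f' ∘ a ->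
  exists c : hom D D', c ∘ g = g' ∘ b /\ fmor Sg a ∘ h = h' ∘ c.
Proof.
exact: (@Delta_TR3 C (Tri f g h) (Tri f' g' h')).
Qed.

(** The trivial triangle on [A] maps to the given one by [idm A] and [f]; the
    third component makes [g ∘ f] factor through zero. *)
Lemma tri_comp0 (A B D : C) (f : hom A B) (g : hom B D) (h : hom D (Sg A)) :
  Delta (Tri f g h) -> g ∘ f = 0.
Proof.
have [[Z Z0] _] := scat_additive C => tr.
have [c [+ _]] :=
  tri_fill_mor ((@Delta_TR1 C).1 A Z Z0) tr (erefl (f ∘ idm A)).
by rewrite compm0.
Qed.

(** Compare with the rotation [P -> 0 -> Sg P] of the trivial triangle. *)
Lemma tri_weak_ker (A B D : C) (f : hom A B) (g : hom B D) (h : hom D (Sg A))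
    (P : C) (u : hom P B) :
  Delta (Tri f g h) -> g ∘ u = 0 -> exists v, f ∘ v = u.
Proof.
have [[Z Z0] _] := scat_additive C => /Delta_rot tr gu0.
have tP := Delta_rot ((@Delta_TR1 C).1 P Z Z0).
have [|c [_]] := tri_fill_mor (a := u) (b := 0) tP tr; first by rewrite comp0m.
have [v ->] := Sg_full c; rewrite fmor1 compmN compm1 compNm -fmorM.
by move=> /oppr_inj/Sg_inj uE; exists v.
Qed.

(** Compare with the rotation [0 -> T -> T] of the trivial triangle. *)
Lemma tri_weak_coker (A B D : C) (f : hom A B) (g : hom B D) (h : hom D (Sg A))
    (T : C) (v : hom B T) :
  Delta (Tri f g h) -> v ∘ f = 0 -> exists w, w ∘ g = v.
Proof.
have [[Z Z0] _] := scat_additive C => tr vf0.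
have tT : Delta (Tri (0 : hom Z T) (idm T) 0).
  apply/Delta_TR2; rewrite fmor0 oppr0.
  exact: ((@Delta_TR1 C).1 _ _ (is_zero_fobj Sg Z0)).
have [|w [wg _]] := tri_fill_mor (a := 0) (b := v) tr tT.
  by rewrite comp0m.
by exists w; rewrite wg comp1m.
Qed.

(** The third object [W] of a triangle on [g] need not be a suspension on the
    nose, so it is replaced by the isomorphic [Sg (Sg' W)] before rotating. *)
Lemma tri_fill (B D : C) (g : hom B D) :
  exists (A : C) (f : hom A B) (h : hom D (Sg A)), Delta (Tri f g h).
Proof.
have [W [h [k tr]]] := (@Delta_TR1 C).2 B D g.
have [e [eV _]] := sg_sgV_iso W; have [f kE] := Sg_full (k ∘ e).
exists (Sg' W), (- f), (sg_sgV W ∘ h); apply/Delta_TR2.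
rewrite fmorN opprK -kE.
apply: Delta_isoP (is_iso_idm _) (is_iso_idm _) (sg_sgV_iso W) _ _ _ tr.
- by rewrite comp1m compm1.
- by rewrite compm1.
- by rewrite fmor1 comp1m -compA eV compm1.
Qed.

Lemma tri_kernel_rel (A B D : C) (f : hom A B) (g : hom B D) (h : hom D (Sg A)) :
  Delta (Tri f g h) ->
  [/\ g ∘ f = 0, h ∘ g = 0 & fmor Sg f ∘ h = 0].
Proof.
move=> tr; have tr1 := Delta_rot tr; split; first exact: tri_comp0 tr.
  exact: tri_comp0 tr1.
by apply: oppr_inj; rewrite -compNm oppr0; apply: tri_comp0 (Delta_rot tr1).
Qed.

(** Octahedron on the composite [E -> D -> Sg A], whose three cones are [Sg M],
    [Sg B] and [Sg G]; it returns the suspension of [M -> G -> B]. *)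
Lemma base_change_exists (A B D E G : C)
    (f : hom A B) (g : hom B D) (h : hom D (Sg A)) (e : hom E D)
    (f' : hom A G) (g' : hom G E) :
  Delta (Tri f g h) -> Delta (Tri f' g' (h ∘ e)) ->
  exists (M : C) (a : hom M G) (b : hom G B) (d : hom M E) (z : hom D (Sg M)),
    base_change f g h f' g' (h ∘ e) a b (z ∘ g) d e z.
Proof.
move=> tr tr'; have [M [d [z trz]]] := tri_fill e.
have [u [v [tuv uz]]] := Delta_TR4 (Delta_rot trz)
  (Delta_rot (Delta_rot tr)) (Delta_rot (Delta_rot tr')).
have [a ua] := Sg_full u; have [b vb] := Sg_full v; subst u v.
rewrite !compNm !compmN -!fmorM => /oppr_inj/Sg_inj g'a /oppr_inj/Sg_inj bf'.
move=> /oppr_inj/Sg_inj eg'.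
exists M, a, b, d, z; split=> //.
apply/Delta_rot3/(Delta_signs _ _ _).1.1; rewrite !opprK fmorM.
by rewrite compmN in tuv.
Qed.

(** Octahedron on the composite [D -> Sg A -> Sg E], whose three cones are
    [Sg B], [Sg (Sg N)] and [Sg F]; it returns, up to sign, the suspension of
    [B -> F -> Sg N]. *)
Lemma cobase_change_exists (A B D E F : C)
    (f : hom A B) (g : hom B D) (h : hom D (Sg A)) (a : hom A E)
    (f' : hom E F) (g' : hom F D) :
  Delta (Tri f g h) -> Delta (Tri f' g' (fmor Sg a ∘ h)) ->
  exists (N : C) (z : hom N A) (d : hom N B) (b : hom B F) (c : hom F (Sg N)),
    cobase_change f g h f' g' (fmor Sg a ∘ h) z a (c ∘ f') d b c.
Proof.
move=> tr tr'; have [N [z [e tra]]] := tri_fill a.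
have tra' : Delta (Tri (fmor Sg a) (fmor Sg e) (fmor Sg (fmor Sg z))).
  have /(Delta_rot3 _ _ _).1 := Delta_rot tra.
  by rewrite fmorN opprK => /(Delta_signs _ _ _).1.1.
have [u [v [tuv uf]]] := Delta_TR4 (Delta_rot (Delta_rot tr)) tra'
  (Delta_rot (Delta_rot tr')).
have [b ub] := Sg_full u; have [c' vc'] := Sg_full v; subst u v.
rewrite !compNm !compmN -!fmorM -!fmorN => /Sg_inj/oppr_inj g'b /Sg_inj ce _.
have bf : b ∘ f = f' ∘ a.
  by move: uf; rewrite compmN compNm -!fmorM => /oppr_inj/Sg_inj.
have trb : Delta (Tri (f ∘ z) b (- c')).
  apply/Delta_TR2/Delta_rot3/(Delta_signs _ _ _).1.2.
  rewrite opprK !fmorN !opprK.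
  by rewrite fmorN compNm -!fmorM in tuv.
exists N, z, (f ∘ z), b, (- c'); split=> //.
by rewrite compNm ce.
Qed.

(** ** Exactness of Hom functors *)

Lemma hom_epiP (A B D : C) (f : hom A B) (g : hom B D) (h : hom D (Sg A))
    (P : C) :
  Delta (Tri f g h) ->
  (forall w : hom P D, exists u : hom P B, g ∘ u = w) <->
  (forall w : hom P D, h ∘ w = 0).
Proof.
move=> tr; have [_ hg _] := tri_kernel_rel tr; split=> H w.
  by have [u <-] := H w; rewrite compA hg comp0m.
exact: tri_weak_ker (Delta_rot tr) (H w).
Qed.

Lemma hom_monoP (A B D : C) (f : hom A B) (g : hom B D) (h : hom D (Sg A))
    (P : C) :
  Delta (Tri f g h) ->
  injective (fun u : hom P A => f ∘ u) <->
  (forall w : hom (Sg P) D, h ∘ w = 0).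
Proof.
move=> tr; have [_ _ fh] := tri_kernel_rel tr; split=> [f_inj w | H u v fuv].
  have [u hw] := Sg_full (h ∘ w).
  suff -> : h ∘ w = fmor Sg 0 by rewrite fmor0.
  rewrite hw; congr fmor; apply: f_inj; rewrite compm0.
  by apply: Sg_eq0; rewrite fmorM -hw compA fh comp0m.
apply/eqP; rewrite -subr_eq0; apply/eqP/Sg_eq0.
have [|w <-] := tri_weak_ker (u := fmor Sg (u - v)) (Delta_rot (Delta_rot tr)).
  by rewrite compNm -fmorM compBr fuv subrr fmor0 oppr0.
exact: H.
Qed.

Lemma cohom_epiP (A B D : C) (f : hom A B) (g : hom B D) (h : hom D (Sg A))
    (I : C) :
  Delta (Tri f g h) ->
  (forall w : hom A I, exists u : hom B I, u ∘ f = w) <->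
  (forall w : hom A I, fmor Sg w ∘ h = 0).
Proof.
move=> tr; have [_ _ fh] := tri_kernel_rel tr; split=> H w.
  by have [u <-] := H w; rewrite fmorM -compA fh compm0.
have [u' uE] := tri_weak_coker (Delta_rot (Delta_rot tr)) (H w).
have [u u'E] := Sg_full u'; exists (- u); apply: Sg_inj.
by rewrite -uE u'E fmorM fmorN compNm compmN.
Qed.

Lemma cohom_monoP (A B D : C) (f : hom A B) (g : hom B D) (h : hom D (Sg A))
    (I : C) :
  Delta (Tri f g h) ->
  injective (fun u : hom D I => u ∘ g) <->
  (forall w : hom (Sg A) I, w ∘ h = 0).
Proof.
move=> tr; have [_ hg _] := tri_kernel_rel tr; split=> [g_inj w | H u v guv].
  by apply: g_inj; rewrite comp0m -compA hg compm0.
apply/eqP; rewrite -subr_eq0; apply/eqP.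
have [|w <-] := tri_weak_coker (v := u - v) (Delta_rot tr).
  by rewrite compBl guv subrr.
exact: H.
Qed.

Lemma hom_short_exactP (A B D : C) (f : hom A B) (g : hom B D)
    (h : hom D (Sg A)) (P : C) :
  Delta (Tri f g h) ->
  short_exact (fun u : hom P A => f ∘ u) (fun u : hom P B => g ∘ u) <->
  injective (fun u : hom P A => f ∘ u) /\
  (forall w : hom P D, exists u : hom P B, g ∘ u = w).
Proof.
move=> tr; have [gf _ _] := tri_kernel_rel tr.
split=> [[] | [f_inj g_surj]] //; split=> // u; split.
  exact: tri_weak_ker tr.
by case=> v <-; rewrite compA gf comp0m.
Qed.

Lemma cohom_short_exactP (A B D : C) (f : hom A B) (g : hom B D)
    (h : hom D (Sg A)) (I : C) :
  Delta (Tri f g h) ->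
  short_exact (fun u : hom D I => u ∘ g) (fun u : hom B I => u ∘ f) <->
  injective (fun u : hom D I => u ∘ g) /\
  (forall w : hom A I, exists u : hom B I, u ∘ f = w).
Proof.
move=> tr; have [gf _ _] := tri_kernel_rel tr.
split=> [[] | [g_inj f_surj]] //; split=> // u; split.
  exact: tri_weak_coker tr.
by case=> v <-; rewrite -compA gf compm0.
Qed.

(** Since [g] kills [idm B - s ∘ g], this difference factors as [f ∘ r]; the
    section also forces [h = 0], which makes [f] cancellable on the left and
    gives the remaining relations on [r]. *)
Lemma split_epi_biproduct (A B D : C) (f : hom A B) (g : hom B D)
    (h : hom D (Sg A)) (s : hom D B) :
  Delta (Tri f g h) -> g ∘ s = idm D ->
  exists r : hom B A, is_biproduct s f g r.
Proof.
move=> tr gs; have [gf hg _] := tri_kernel_rel tr.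
have h0 : h = 0 by rewrite -[h]compm1 -gs compA hg comp0m.
have f_inj P : injective (fun u : hom P A => f ∘ u).
  by apply/(hom_monoP P tr) => w; rewrite h0 comp0m.
have [|r fr] := tri_weak_ker (u := idm B - s ∘ g) tr.
  by rewrite compBr compA gs comp1m compm1 subrr.
exists r; split=> //; last by rewrite fr addrC subrK.
  by apply: f_inj; rewrite compA fr compBl -compA gf compm0 subr0 comp1m compm1.
apply: f_inj.
by rewrite compA fr compBl -compA gs compm1 comp1m subrr compm0.
Qed.

(** Since [idm B - f ∘ r] kills [f], it factors as [s ∘ g], and [g] is
    cancellable on the right because [h = 0]. *)
Lemma split_mono_biproduct (A B D : C) (f : hom A B) (g : hom B D)
    (h : hom D (Sg A)) (r : hom B A) :
  Delta (Tri f g h) -> r ∘ f = idm A ->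
  exists s : hom D B, is_biproduct f s r g.
Proof.
move=> tr rf; have [gf _ fh] := tri_kernel_rel tr.
have h0 : h = 0 by rewrite -[h]comp1m -fmor1 -rf fmorM -compA fh compm0.
have g_inj I : injective (fun u : hom D I => u ∘ g).
  by apply/(cohom_monoP I tr) => w; rewrite h0 compm0.
have [|s sg] := tri_weak_coker (v := idm B - f ∘ r) tr.
  by rewrite compBl -compA rf comp1m compm1 subrr.
exists s; split=> //; last by rewrite sg addrC subrK.
  by apply: g_inj; rewrite -compA sg compBr compA gf comp0m subr0 comp1m compm1.
apply: g_inj.
by rewrite -compA sg compBr compA rf compm1 comp1m subrr comp0m.
Qed.

(** ** Phantom morphisms *)

Definition phantom_map (X : set C) (D A : C) (h : hom D (Sg A)) : Prop :=
  forall P, X P -> forall w : hom P D, h ∘ w = 0.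

Definition cophantom_map (Y : set C) (D A : C) (h : hom D (Sg A)) : Prop :=
  forall I, Y I -> forall w : hom A I, fmor Sg w ∘ h = 0.

(** Surjectivity of [Hom (P, g)] is the vanishing of [h] on maps from [P], and
    injectivity of [Hom (P, f)] is its vanishing on maps from [Sg P]; closure
    of [X] under suspension absorbs the second condition into the first. *)
Lemma xi_contraP (X : set C) (t : tri C) :
  (forall A, X A -> X (Sg A)) ->
  xi_contra X t <-> Delta t /\ phantom_map X (th t).
Proof.
case: t => A B D f g h XS; split=> -[tr H]; split=> // P XP /=.
  by apply/(hom_epiP P tr); case: (H P XP).
split; first by apply/(hom_monoP P tr)/H/XS.
exact/(hom_epiP P tr)/H.
Qed.

(** Here surjectivity of [Hom (f, I)] gives the condition on [h], and
    injectivity of [Hom (g, I)] follows from the same condition on a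
    desuspension of [I]. *)
Lemma xi_coP (Y : set C) (t : tri C) :
  (forall I, Y I -> exists J : C, Y J /\ isomorphic I (Sg J)) ->
  xi_co Y t <-> Delta t /\ cophantom_map Y (th t).
Proof.
case: t => A B D f g h YS; split=> -[tr H]; split=> // I YI /=.
  by apply/(cohom_epiP I tr); case: (H I YI).
split; last exact/(cohom_epiP I tr)/H.
have [J [YJ [e ie]]] := YS I YI.
apply/(cohom_monoP I tr) => w; have [v ev] := Sg_full (e ∘ w).
by apply: (iso_mono ie); rewrite compA ev compm0; apply: H.
Qed.

End Triangles.

(** * The class of triangles relative to [X] is proper *)

Section XiContra.
Local Open Scope ring_scope.
Local Open Scope cat_scope.
Variable C : triangulated.

Lemma Delta_susp (t : tri C) : Delta t -> Delta (tri_susp t).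
Proof. by case: t => A B D f g h /Delta_rot3. Qed.

(** Suspending the desuspended triangle gives, up to signs, one that the unit
    [A ~ Sg (Sg' A)] identifies with [t]; the square at the connecting
    morphism is the triangle identity. *)
Lemma Delta_desusp (t : tri C) : Delta t -> Delta (tri_desusp t).
Proof.
case: t => A B D f g h tr; apply/Delta_rot3; rewrite /= !fmorN !opprK.
apply: Delta_isoP (sg_sgV_iso A) (sg_sgV_iso B) (sg_sgV_iso D) _ _ _ tr.
- exact: sg_sgV_nat.
- exact: sg_sgV_nat.
- rewrite !fmorM -!compA -(sg_sgV_nat h) (compA (fmor Sg (sgV_sg A))).
  by rewrite sg_triangle comp1m.
Qed.

Variable X : set C.
Hypothesis XS : sg_stable X.

Let xiP t : xi_contra X t <-> Delta t /\ phantom_map X (th t).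
Proof. by apply: xi_contraP; case: XS. Qed.

Lemma xi_contra_susp t : xi_contra X t -> xi_contra X (tri_susp t).
Proof.
case/xiP=> tr ph; apply/xiP; split; first exact: Delta_susp.
case: t tr ph => A B D f g h /= tr ph P XP w.
have [Q [XQ [e [e' [e'e _]]]]] := XS.2 P XP.
have [v vE] := Sg_full (w ∘ e').
rewrite -[w]compm1 -e'e (compA w) vE compNm compA -fmorM ph //.
by rewrite fmor0 comp0m oppr0.
Qed.

Lemma xi_contra_desusp t : xi_contra X t -> xi_contra X (tri_desusp t).
Proof.
case/xiP=> tr ph; apply/xiP; split; first exact: Delta_desusp.
case: t tr ph => A B D f g h /= tr ph P XP w.
suff hw0 : fmor Sg' h ∘ w = 0 by rewrite compNm -compA hw0 compm0 oppr0.
have [e [_ Ve]] := sg_sgV_iso D.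
apply: Sg_eq0; rewrite fmorM -[fmor Sg (fmor Sg' h)]compm1 -Ve compA.
by rewrite -sg_sgV_nat -!compA ph ?compm0 //; apply: XS.1.
Qed.

Lemma xi_contra_iso : iso_closed (xi_contra X).
Proof.
move=> s t st /xiP[tr ph]; apply/xiP; split; first exact: Delta_iso st tr.
case: st => m [_ _ [c' [_ cc']]] P XP w.
by rewrite -[w]comp1m -cc' -compA compA -(mCA m) -compA ph ?compm0.
Qed.

Lemma xi_contra_coprod : coprod_closed (xi_contra X).
Proof.
split=> [t tr A0 _ _ | s s' t tr].
  apply/xiP; split=> // P _ w; apply: hom_to0; exact: is_zero_fobj.
case/xiP=> _ ph /xiP[_ ph'] [i [j [_ _ /coprod_proj[p [q pq]]]]].
apply/xiP; split=> // P XP w.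
rewrite -[w]comp1m -pq compDl compDr -!compA !(compA (th t)).
by rewrite -(mCA i) -(mCA j) -!compA ph // ph' // !compm0 addr0.
Qed.

(** Saturation: a map [w] from [X] to [D] is killed by [z], hence lifts to [E]
    along [e], and there [h ∘ e] kills it. The two base changes replace [h] by
    [h ∘ e] and by [Sg a ∘ h]. *)
Lemma xi_contra_proper : proper_class (xi_contra X).
Proof.
split.
- by move=> t [].
- by move=> t [tr h0]; apply/xiP; split=> // P _ w; rewrite h0 comp0m.
- exact: xi_contra_iso.
- exact: xi_contra_coprod.
- case=> n t xt; first by elim: n => //= n; apply: xi_contra_susp.
  by rewrite /tri_shift; elim: n.+1 => //= m; apply: xi_contra_desusp.
- move=> A B D E G M f g h f' g' h' a b c d e z [tr _ _ trD _ _ -> _ _].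
  case/xiP=> _ phz /xiP[_ phhe]; apply/xiP; split=> // P XP w.
  have [|v <-] := tri_weak_ker (u := w) (Delta_rot trD); first exact: phz.
  by rewrite compA; apply: phhe.
- move=> A B D E G M f g h f' g' h' a b c d e z [_ tr' _ _ _ _ hE _ _].
  case/xiP=> _ /= ph; apply/xiP; split=> //= P XP w.
  by rewrite hE -compA; apply: ph.
- move=> A B D E F N f g h f' g' h' z a e d b c [_ tr' _ _ _ _ hE _ _].
  case/xiP=> _ /= ph; apply/xiP; split=> //= P XP w.
  by rewrite hE -compA (ph _ XP) compm0.
Qed.

End XiContra.

(** * Projectives and injectives of a proper class *)

Section Proper.
Local Open Scope ring_scope.
Local Open Scope cat_scope.
Variables (C : triangulated) (xi : set (tri C)).
Hypothesis xi_proper : proper_class xi.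

Lemma proper_precomp (A B D E G : C) (f : hom A B) (g : hom B D)
    (h : hom D (Sg A)) (e : hom E D) (f' : hom A G) (g' : hom G E) :
  xi (Tri f g h) -> Delta (Tri f' g' (h ∘ e)) -> xi (Tri f' g' (h ∘ e)).
Proof.
move=> xit tr'; have tr := proper_sub xi_proper xit.
have [M [a [b [d [z bc]]]]] := base_change_exists tr tr'.
exact: (proper_base_change xi_proper bc xit).
Qed.

Lemma proper_postcomp (A B D E F : C) (f : hom A B) (g : hom B D)
    (h : hom D (Sg A)) (a : hom A E) (f' : hom E F) (g' : hom F D) :
  xi (Tri f g h) -> Delta (Tri f' g' (fmor Sg a ∘ h)) ->
  xi (Tri f' g' (fmor Sg a ∘ h)).
Proof.
move=> xit tr'; have tr := proper_sub xi_proper xit.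
have [N [z [d [b [c cbc]]]]] := cobase_change_exists tr tr'.
exact: (proper_cobase_change xi_proper cbc xit).
Qed.

Let xi_susp t : xi t -> xi (tri_susp t).
Proof. exact: (proper_susp xi_proper 1%N). Qed.

Let xi_desusp t : xi t -> xi (tri_desusp t).
Proof. exact: (proper_susp xi_proper (Negz 0)). Qed.

(** Injectivity of [Hom (P, f)] concerns maps [Sg P -> D]; these are tested
    against the desuspended triangle. *)
Lemma ProjP (P : C) :
  Proj xi P <-> forall t, xi t -> forall w : hom P (tC t), th t ∘ w = 0.
Proof.
split=> [prP | H] [A B D f g h] xit; have tr := proper_sub xi_proper xit.
  by apply/(hom_epiP P tr); have /(hom_short_exactP P tr)[] := prP _ xit.
apply/(hom_short_exactP P tr); split; last exact/(hom_epiP P tr)/(H _ xit).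
apply/(hom_monoP P tr) => w.
have [e [eV Ve]] := sgV_sg_iso P.
have /= := H _ (xi_desusp xit) (fmor Sg' w ∘ e).
rewrite compNm => hw0; apply: Sg'_eq0; rewrite fmorM.
apply: (iso_epi (f := e)); first by exists (sgV_sg P).
apply: (iso_mono (sgV_sg_iso A)); apply: (iso_mono (sg_sgV_iso A)).
by rewrite comp0m !compm0 !compA; apply: oppr_inj; rewrite oppr0 -hw0 !compA.
Qed.

(** Injectivity of [Hom (g, I)] concerns maps [Sg A -> I]; these are tested
    against the suspended triangle. *)
Lemma InjP (I : C) :
  Inj xi I <-> forall t, xi t -> forall w : hom (tA t) I, fmor Sg w ∘ th t = 0.
Proof.
split=> [inI | H] [A B D f g h] xit; have tr := proper_sub xi_proper xit.
  by apply/(cohom_epiP I tr); have /(cohom_short_exactP I tr)[] := inI _ xit.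
apply/(cohom_short_exactP I tr); split; last exact/(cohom_epiP I tr)/(H _ xit).
apply/(cohom_monoP I tr) => w; have /= := H _ (xi_susp xit) w.
by rewrite compmN -fmorM => wh0; apply/Sg_eq0/oppr_inj; rewrite oppr0.
Qed.

(** Stability under [Sg] is the injectivity half of exactness of [Hom (P, -)];
    [Sg' P] is a desuspension of [P] because its maps, once suspended, are
    tested against suspended triangles. *)
Lemma Proj_admissible : admissible_subcat (Proj xi).
Proof.
split.
- split=> [P /[dup] prP /ProjP prP' | P /ProjP prP].
    apply/ProjP=> -[A B D f g h] xit /=.
    have tr := proper_sub xi_proper xit.
    by apply/(hom_monoP P tr); have /(hom_short_exactP P tr)[] := prP _ xit.
  exists (Sg' P); split; last by exists (sg_sgV P); apply: sg_sgV_iso.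
  apply/ProjP=> -[A B D f g h] xit w /=; apply: Sg_eq0.
  apply: (iso_epi (sg_sgV_iso P)).
  have /= := prP _ (xi_susp xit) (fmor Sg w ∘ sg_sgV P).
  by rewrite compNm comp0m compA -fmorM => hw0; apply/oppr_inj; rewrite oppr0.
- have [[Z Z0] bip] := scat_additive C; split.
    by exists Z; split=> //; apply/ProjP=> t _ w; apply: hom_from0.
  move=> P Q /ProjP prP /ProjP prQ; have [S [i [j [p [q b]]]]] := bip P Q.
  exists S, i, j, p, q; split=> //; apply/ProjP=> t xit w.
  have [_ _ _ _ ijpq] := b.
  by rewrite -[w]compm1 -ijpq !compDr !compA -!(compA (th t) w) prP // prQ //
    !comp0m addr0.
- move=> P P' S i j p q [pi _ _ _ _] /ProjP prS; apply/ProjP=> t xit w.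
  by rewrite -[w]compm1 -pi !compA -(compA (th t)) prS // comp0m.
Qed.

(** Maps into [Sg I] are tested against desuspended triangles, maps into
    [Sg' I] against suspended ones. *)
Lemma Inj_admissible : admissible_subcat (Inj xi).
Proof.
split.
- split=> [I /InjP inI | I /[dup] inI /InjP inI'].
    apply/InjP=> t xit w; apply: Sg'_eq0; rewrite fmorM.
    apply: (iso_mono (sgV_sg_iso (Sg I))); rewrite compm0 compA -sgV_sg_nat.
    have := inI _ (xi_desusp xit) (sgV_sg I ∘ fmor Sg' w).
    rewrite /= compmN fmorM !compA -(compA _ (fmor Sg _)) -sg_sgV_nat compA.
    by rewrite sg_triangle comp1m => wh0; apply/oppr_inj; rewrite oppr0.
  exists (Sg' I); split; last by exists (sg_sgV I); apply: sg_sgV_iso.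
  apply/InjP=> t xit w; have [e [eV Ve]] := sg_sgV_iso I.
  apply: (iso_mono (f := e)); first by exists (sg_sgV I).
  rewrite compm0 compA; apply: Sg_eq0; rewrite fmorM.
  by have /= := inI' _ (xi_susp xit) (e ∘ fmor Sg w);
    rewrite compmN => wh0; apply/oppr_inj; rewrite oppr0.
- have [[Z Z0] bip] := scat_additive C; split.
    exists Z; split=> //; apply/InjP=> t _ w.
    by rewrite [w]hom_to0 // fmor0 comp0m.
  move=> I J /InjP inI /InjP inJ; have [S [i [j [p [q b]]]]] := bip I J.
  exists S, i, j, p, q; split=> //; apply/InjP=> t xit w.
  have [_ _ _ _ ijpq] := b.
  by rewrite -[w]comp1m -ijpq !compDl -!compA fmorD !(fmorM _ i) !(fmorM _ j)
    compDl -!compA inI // inJ // !compm0 addr0.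
- move=> I I' S i j p q [pi _ _ _ _] /InjP inS; apply/InjP=> t xit w.
  by rewrite -[w]comp1m -pi -!compA (fmorM _ p) -compA inS // compm0.
Qed.

(** If [K -> P -p-> D -z-> Sg K] is in [xi] and [h ∘ p = 0], then [h] factors as
    [Sg w ∘ z], and this composite inherits membership from [z]. *)
Lemma xi_contra_Proj : enough_projectives xi -> xi_contra (Proj xi) = xi.
Proof.
move=> enough; have [[PS _] _ _] := Proj_admissible.
apply/seteqP; split=> [[A B D f g h] | t xit].
  case/(xi_contraP _ PS) => /= tr ph.
  have [K [P [d [p [z [prP xiP]]]]]] := enough D.
  have trP := Delta_rot (proper_sub xi_proper xiP).
  have [v vz] := tri_weak_coker trP (ph P prP p).
  have [w wE] := Sg_full v; subst v; move: tr; rewrite -vz.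
  exact: proper_postcomp xiP.
apply/(xi_contraP _ PS); split; first exact: proper_sub xi_proper _ xit.
by move=> P /ProjP prP; apply: prP.
Qed.

(** If [A -j-> I -> K -k-> Sg A] is in [xi] and [Sg j ∘ h = 0], then [h] factors
    as [k ∘ w], and this composite inherits membership from [k]. *)
Lemma xi_co_Inj : enough_injectives xi -> xi_co (Inj xi) = xi.
Proof.
move=> enough; have [[_ IS] _ _] := Inj_admissible.
apply/seteqP; split=> [[A B D f g h] | t xit].
  case/(xi_coP _ IS) => /= tr ph.
  have [I [K [j [q [k [inI xiI]]]]]] := enough A.
  have trI := Delta_rot (Delta_rot (proper_sub xi_proper xiI)).
  have [|w kw] := tri_weak_ker (u := h) trI.
    by rewrite compNm [X in - X](ph I inI j) oppr0.
  move: tr; rewrite -kw; exact: proper_precomp xiI.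
apply/(xi_coP _ IS); split; first exact: proper_sub xi_proper _ xit.
by move=> I /InjP inI; apply: inI.
Qed.

End Proper.

(** * Balanced pairs *)

Section Balanced.
Local Open Scope ring_scope.
Local Open Scope cat_scope.
Variable C : triangulated.
Implicit Types (X Y : set C) (xi : set (tri C)).

(** With [X := Proj xi], respectively [Y := Inj xi], these are convertible to
    [enough_projectives xi] and [enough_injectives xi]. *)
Definition has_covers X xi : Prop :=
  forall A : C, exists (K P : C) (f : hom K P) (g : hom P A) (h : hom A (Sg K)),
    X P /\ xi (Tri f g h).

Definition has_envelopes Y xi : Prop :=
  forall A : C, exists (I K : C) (f : hom A I) (g : hom I K) (h : hom K (Sg A)),
    Y I /\ xi (Tri f g h).

(** Choose a triangle [K A -> P A -> A] for every [A] and splice those at the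
    iterates of [K]. *)
Lemma splice_left X xi (M : C) :
  has_covers X xi ->
  exists (Xs : nat -> C) (d : forall n, hom (Xs n.+1) (Xs n))
    (aug : hom (Xs 0%N) M), (forall n, X (Xs n)) /\ exact_left xi d aug.
Proof.
move=> /choice[K /choice[P cover]].
pose Ks := fix Ks n := K (if n is m.+1 then Ks m else M).
(* Only propositional: [Ks n] does not reduce until [n] is a constructor. *)
have KsE n : Ks n = K (syzygy M Ks n) by case: n.
have {}cover n : exists t : hom (Ks n) (P (syzygy M Ks n)) *
    hom (P (syzygy M Ks n)) (syzygy M Ks n) * hom (syzygy M Ks n) (Sg (Ks n)),
    X (P (syzygy M Ks n)) /\ xi (Tri t.1.1 t.1.2 t.2).
  rewrite KsE; have [f [g [h H]]] := cover (syzygy M Ks n).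
  by exists (f, g, h).
pose t n := sval (cid (cover n)); have tP n := svalP (cid (cover n)).
exists (fun n => P (syzygy M Ks n)), (fun n => (t n).1.1 ∘ (t n.+1).1.2),
  (t 0%N).1.2; split=> [n | ]; first by case: (tP n).
exists Ks, (fun n => (t n).1.1), (fun n => (t n).1.2), (fun n => (t n).2).
by split=> // n; have [] := tP n.
Qed.

Lemma splice_right Y xi (M : C) :
  has_envelopes Y xi ->
  exists (Ys : nat -> C) (d : forall n, hom (Ys n) (Ys n.+1))
    (coaug : hom M (Ys 0%N)), (forall n, Y (Ys n)) /\ exact_right xi d coaug.
Proof.
move=> /choice[I /choice[K cover]].
pose Ks := fix Ks n := K (if n is m.+1 then Ks m else M).
(* Only propositional: [Ks n] does not reduce until [n] is a constructor. *)
have KsE n : Ks n = K (syzygy M Ks n) by case: n.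
have {}cover n : exists t : hom (syzygy M Ks n) (I (syzygy M Ks n)) *
    hom (I (syzygy M Ks n)) (Ks n) * hom (Ks n) (Sg (syzygy M Ks n)),
    Y (I (syzygy M Ks n)) /\ xi (Tri t.1.1 t.1.2 t.2).
  rewrite KsE; have [f [g [h H]]] := cover (syzygy M Ks n).
  by exists (f, g, h).
pose t n := sval (cid (cover n)); have tP n := svalP (cid (cover n)).
exists (fun n => I (syzygy M Ks n)), (fun n => (t n.+1).1.1 ∘ (t n).1.2),
  (t 0%N).1.1; split=> [n | ]; first by case: (tP n).
exists Ks, (fun n => (t n).1.1), (fun n => (t n).1.2), (fun n => (t n).2).
by split=> // n; have [] := tP n.
Qed.

Lemma resolution_covers X Y :
  (forall M, has_resolution X Y M) -> has_covers X (xi_contra X `&` xi_co Y).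
Proof.
move=> res M; case: (res M) => Xs [d [aug [XXs [K [g [f [h [_ _ xis]]]]]]]].
exists (K 0%N), (Xs 0%N), (g 0%N), (f 0%N), (h 0%N).
by split; [apply: XXs | apply: (xis 0%N)].
Qed.

Lemma coresolution_envelopes X Y :
  (forall N, has_coresolution X Y N) ->
  has_envelopes Y (xi_co Y `&` xi_contra X).
Proof.
move=> cores N; case: (cores N) => Ys [d [coaug [YYs [K [g [f [h [_ _ xis]]]]]]]].
exists (Ys 0%N), (K 0%N), (g 0%N), (f 0%N), (h 0%N).
by split; [apply: YYs | apply: (xis 0%N)].
Qed.

Lemma sub_Proj X : X `<=` Proj (xi_contra X).
Proof.
by move=> P XP [A B D f g h] [tr ex]; apply/(hom_short_exactP P tr)/ex.
Qed.

Lemma sub_Inj Y : Y `<=` Inj (xi_co Y).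
Proof.
by move=> I YI [A B D f g h] [tr ex]; apply/(cohom_short_exactP I tr)/ex.
Qed.

(** A projective [P] lifts its identity along a cover, and so is a summand of an
    object of [X]. *)
Lemma Proj_xi_contra X : summand_closed X ->
  has_covers X (xi_contra X) ->
  Proj (xi_contra X) = X.
Proof.
move=> Xsum cover; apply/seteqP; split; last exact: sub_Proj.
move=> P prP; have [K [Q [f [g [h [XQ xit]]]]]] := cover P.
have [_ _ /(_ (idm P))[s gs]] := prP _ xit.
have [r bip] := split_epi_biproduct xit.1 gs.
exact: Xsum bip XQ.
Qed.

Lemma Inj_xi_co Y : summand_closed Y ->
  has_envelopes Y (xi_co Y) ->
  Inj (xi_co Y) = Y.
Proof.
move=> Ysum env; apply/seteqP; split; last exact: sub_Inj.
move=> I inI; have [J [K [f [g [h [YJ xit]]]]]] := env I.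
have [_ _ /(_ (idm I))[r rf]] := inI _ xit.
have [s bip] := split_mono_biproduct xit.1 rf.
exact: Ysum bip YJ.
Qed.

(** As for [xi_contra_Proj], [h] factors as [Sg w ∘ z] with [z] the connecting
    morphism of the first triangle of a resolution of [D]; that triangle is
    also in [xi_co Y], so suspended maps to [Y] kill [z], hence [h]. *)
Lemma xi_contra_sub_co X Y : sg_stable X -> sg_stable Y ->
  (forall M, has_resolution X Y M) -> xi_contra X `<=` xi_co Y.
Proof.
move=> [XS _] [_ YS] res [A B D f g h] /(xi_contraP _ XS)[/= tr ph].
have [K [P [i [p [z [XP [[trz _] /(xi_coP _ YS)[_ coz]]]]]]]] :=
  resolution_covers res D.
have [v vz] := tri_weak_coker (Delta_rot trz) (ph P XP p).
have [w wE] := Sg_full v; subst v.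
apply/(xi_coP _ YS); split=> //= I YI u.
by rewrite -vz compA -fmorM; apply: coz.
Qed.

Lemma xi_co_sub_contra X Y : sg_stable X -> sg_stable Y ->
  (forall N, has_coresolution X Y N) -> xi_co Y `<=` xi_contra X.
Proof.
move=> [XS _] [_ YS] cores [A B D f g h] /(xi_coP _ YS)[/= tr ph].
have [I [K [j [q [k [YI [[trk _] /(xi_contraP _ XS)[_ phk]]]]]]]] :=
  coresolution_envelopes cores A.
have [|w kw] := tri_weak_ker (u := h) (Delta_rot (Delta_rot trk)).
  by rewrite compNm [X in - X](ph I YI j) oppr0.
apply/(xi_contraP _ XS); split=> //= P XP u.
by rewrite -kw -compA; apply: phk.
Qed.

(** The covers and envelopes at the start of the resolutions already give back
    enough projectives and injectives, so only the first triangle of each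
    resolution matters in that direction. *)
Lemma balanced_resolutionE : balanced_resolution C = balanced_proj_inj C.
Proof.
apply/esym/seteqP; split=> -[X Y].
  case=> admX admY xiE [XE YE enP enI]; split=> //.
  - split=> D.
      have [K [P [f [g [h [prP [_ ex]]]]]]] := enP D.
      exists P, g; rewrite XE; split=> // P' prP'.
      by apply: (ex P' _).2; rewrite XE.
    have [I [K [f [g [h [inI [_ ex]]]]]]] := enI D.
    exists I, f; rewrite YE; split=> // I' inI'.
    by apply: (ex I' _).2; rewrite YE.
  - by move=> M; apply: splice_left; rewrite -xiE setIid {1}XE.
  - by move=> N; apply: splice_right; rewrite xiE setIid {1}YE.
case=> admX admY _ res cores.
have [[XS _ Xsum] [YS _ Ysum]] := (admX, admY).
have xiE : xi_contra X = xi_co Y.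
  by apply/seteqP; split; [apply: xi_contra_sub_co | apply: xi_co_sub_contra].
have cover : has_covers X (xi_contra X).
  by have := resolution_covers res; rewrite -xiE setIid.
have env : has_envelopes Y (xi_co Y).
  by have := coresolution_envelopes cores; rewrite xiE setIid.
have PE := Proj_xi_contra Xsum cover; have IE := Inj_xi_co Ysum env.
by split=> //; split; rewrite /enough_projectives /enough_injectives ?PE ?IE.
Qed.

Lemma balanced_proper_enough X Y :
  balanced_proj_inj C (X, Y) -> proper_enough C (xi_contra X).
Proof.
case=> -[XS _ _] _ xiE [_ _ enP enI]; split=> //; last by rewrite xiE.
exact: xi_contra_proper.
Qed.

Lemma proper_enough_balanced xi :
  proper_enough C xi -> balanced_proj_inj C (Phi xi).
Proof.
case=> pxi enP enI; split; rewrite ?xi_contra_Proj ?xi_co_Inj //.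
- exact: Proj_admissible.
- exact: Inj_admissible.
Qed.

Lemma PsiK p : balanced_proj_inj C p -> Phi (Psi p) = p.
Proof.
by case: p => X Y [_ _ xiE [XE YE _ _]]; rewrite /Phi -XE /Psi /= xiE -YE.
Qed.

Lemma PhiK xi : proper_enough C xi -> Psi (Phi xi) = xi.
Proof. by case=> pxi enP _; apply: xi_contra_Proj. Qed.

End Balanced.

Lemma set_bij_inverse (T U : Type) (A : set T) (B : set U)
    (f : T -> U) (g : U -> T) :
  (forall x, A x -> B (f x)) -> (forall y, B y -> A (g y)) ->
  (forall x, A x -> g (f x) = x) -> (forall y, B y -> f (g y) = y) ->
  set_bij A B f.
Proof.
move=> fAB gBA fK gK; split=> // [x y /set_mem Ax /set_mem Ay fxy | y By].
  by rewrite -(fK x Ax) fxy fK.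
by exists (g y); [apply: gBA | apply: gK].
Qed.

(* The two equivalent conditions defining balanced pairs are treated on the same
   footing: the statement holds whichever of them is taken as the definition. *)
Theorem theorem1p1 (C : triangulated) (balanced : set (set C * set C))
    (balancedE :
       balanced = balanced_proj_inj C \/ balanced = balanced_resolution C) :
  [/\ (forall X Y : set C, balanced (X, Y) -> xi_contra X = xi_co Y),
      set_bij balanced (proper_enough C) Psi,
      set_bij (proper_enough C) balanced Phi,
      (forall p, balanced p -> Phi (Psi p) = p)
    & (forall xi, proper_enough C xi -> Psi (Phi xi) = xi)].
Proof.
have -> : balanced = balanced_proj_inj C.
  by case: balancedE => // ->; rewrite balanced_resolutionE.
have PsiP p : balanced_proj_inj C p -> proper_enough C (Psi p).
  by case: p => X Y; apply: balanced_proper_enough.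
split; [by move=> X Y [] | | | exact: PsiK | exact: PhiK].
  exact: (set_bij_inverse PsiP (@proper_enough_balanced C) (@PsiK C) (@PhiK C)).
exact: (set_bij_inverse (@proper_enough_balanced C) PsiP (@PhiK C) (@PsiK C)).
Qed.
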